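(* Let $n\in\{0,1,2,\dots\}$. Then for all $\delta\in(0,n+1)$ $$\ln\Bigl(\frac{n+1}{\delta}\Bigr)+(n+1-\delta)<s_n(\delta)<(n+1-\delta)+\frac{n+1-\delta}{\delta}.$$
   Context: For $n\in\{0,1,2,\dots\}$ and $\delta\in(0,n+1)$, $s_n(\delta)$ denotes the unique positive solution $s$ of $$e^s=1+\frac{s^1}{1!}+\dots+\frac{s^n}{n!}+\frac{1}{\delta}\,\frac{s^{n+1}}{n!}.$$ *)

(* Defs.v *)
(* Stdlib real numbers. *)
From Stdlib Require Import Factorial Reals ClassicalEpsilon.
Open Scope R_scope.

(** [sum_f_R0 f n] has the [n + 1] terms [f 0, ..., f n]; the term [k = 0] is
    [s ^ 0 / 0! = 1]. *)
Definition s_equation (n : nat) (delta s : R) : Prop :=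
  exp s = sum_f_R0 (fun k : nat => s ^ k / INR (fact k)) n
          + 1 / delta * (s ^ (n + 1) / INR (fact n)).

(** Definite description: the value is unspecified unless there is exactly one
    positive solution, so a bound on [s_ n delta] can only be obtained by first
    establishing existence and uniqueness. *)
Definition s_ (n : nat) (delta : R) : R :=
  epsilon (inhabits 0) (unique (fun s : R => 0 < s /\ s_equation n delta s)).

(* Main.v *)
Require Import Defs.
From Stdlib Require Import Reals ClassicalEpsilon.
From Stdlib Require Import Factorial Lra Ranalysis5.
From Coquelicot Require Import Coquelicot.
Open Scope R_scope.

(** Write [N = n + 1]. After multiplication by [n! * exp (- s)] the defining
    equation says [delta * g s = s ^ N * exp (- s)], where
    [g s = n! * (1 - exp (- s) * (1 + s/1! + ... + s^n/n!))] is the lower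
    incomplete gamma function of parameter [N], with [g' s = s^n * exp (- s)].
    So [s_n] is the inverse of the function [d s = s * g' s / g s], and both
    bounds are statements about [d]. The basic fact is the Riccati equation
    [s * d' = d * u], where [u = N - s - d].

    - [u < 0] (lemma [rate_gt]), so [d] is strictly decreasing, which gives
      uniqueness of [s_n delta].
    - The upper bound is positivity of [H = (N - d) * (1 + d) - s * d]
      ([gap_pos]). The Riccati equation yields [s * H' + d * H = d * u^2], and
      [g] is an integrating factor, because [s * g' = d * g]: thus
      [(H * g)' = g' * u^2 > 0], while [H * g] vanishes at [0].
    - The lower bound is positivity of [K = s - N + d + ln (d / N)]
      ([log_gap_pos]). The Riccati equation yields [s * K' = H], so the lower
      bound follows from the upper one, as [K] vanishes at [0].

    The upper bound also forces [d s < N * (N + 1) / s], and [u < 0] gives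
    [d (N - delta) > delta]; the intermediate value theorem then gives the
    existence of [s_n delta]. *)

(** * Positivity from a positive derivative *)

(** The minorant [h] stands in for the limit of [f] at [0]: some functions
    it serves divide by a quantity that vanishes at [0], where they are controlled
    by inequalities only. *)
Lemma pos_of_derive_pos (f df h : R -> R) :
  (forall x, 0 < x -> is_derive f x (df x)) ->
  (forall x, 0 < x -> 0 < df x) ->
  continuity_pt h 0 -> h 0 = 0 ->
  (forall x, 0 < x -> h x <= f x) ->
  forall x, 0 < x -> 0 < f x.
Proof.
  intros Hf Hdf Hc H0 Hh x Hx.
  assert (Hinc : forall a b, 0 < a -> a < b -> f a < f b).
  { intros a b Ha Hab.
    apply (incr_function f (Finite 0) p_infty df); simpl; auto.
    intros y Hy _. apply Hdf, Hy. }
  apply Rle_lt_trans with (f (x / 2)); [|apply Hinc; lra].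
  destruct (Rle_lt_dec 0 (f (x / 2))) as [|Hneg]; [assumption|exfalso].
  destruct (Hc (- f (x / 2))) as [alp [Halp Hd]]; [lra|].
  set (t := Rmin (x / 4) (alp / 2)).
  assert (Ht0 : 0 < t) by (apply Rmin_pos; lra).
  assert (Ht1 : t <= x / 4) by apply Rmin_l.
  assert (Ht2 : t <= alp / 2) by apply Rmin_r.
  assert (Hht : Rabs (h t - h 0) < - f (x / 2)).
  { apply Hd. split.
    - split; [exact I|lra].
    - simpl. unfold Rdist. rewrite Rabs_pos_eq; lra. }
  rewrite H0 in Hht. apply Rabs_def2 in Hht.
  specialize (Hh t Ht0).
  assert (f t < f (x / 2)) by (apply Hinc; lra).
  lra.
Qed.

Lemma pos_of_derive_pos_0 (f df : R -> R) :
  (forall x, is_derive f x (df x)) ->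
  (forall x, 0 < x -> 0 < df x) ->
  f 0 = 0 -> forall x, 0 < x -> 0 < f x.
Proof.
  intros Hf Hdf H0. apply pos_of_derive_pos with df f; auto.
  - apply derivable_continuous_pt. exists (df 0). apply is_derive_Reals, Hf.
  - intros. apply Rle_refl.
Qed.

(** * The lower incomplete gamma function *)

(** Closed form of the integral of [u ^ n * exp (- u)] over [0 <= u <= s]. *)
Definition lower_gamma (n : nat) (s : R) : R :=
  INR (fact n) * (1 - exp (- s) * sum_f_R0 (fun k => s ^ k / INR (fact k)) n).

Lemma is_derive_exp_taylor (n : nat) (s : R) :
  is_derive (fun x => exp (- x) * sum_f_R0 (fun k => x ^ k / INR (fact k)) n) s
    (- (exp (- s) * (s ^ n / INR (fact n)))).
Proof.
  induction n as [|n IH].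
  - apply is_derive_ext with (fun x => exp (- x)).
    + intros t. change (exp (- t) = exp (- t) * (1 / 1)). field.
    + auto_derive; [exact I|]. simpl. field.
  - apply is_derive_ext with
      (fun x => exp (- x) * sum_f_R0 (fun k => x ^ k / INR (fact k)) n
                + exp (- x) * (x ^ S n / INR (fact (S n)))).
    + intros t. symmetry. apply Rmult_plus_distr_l.
    + replace (- (exp (- s) * (s ^ S n / INR (fact (S n))))) with
        (- (exp (- s) * (s ^ n / INR (fact n)))
         + (exp (- s) * (s ^ n / INR (fact n))
            - exp (- s) * (s ^ S n / INR (fact (S n))))) by ring.
      apply (is_derive_plus (V := R_NormedModule)); [exact IH|].
      auto_derive; [exact I|].
      assert (Hf : INR (fact n) <> 0) by apply INR_fact_neq_0.
      assert (HN : INR (S n) <> 0) by (apply not_0_INR; discriminate).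
      change (match n with 0%nat => 1 | S _ => INR n + 1 end) with (INR (S n)).
      change (fact n + n * fact n)%nat with (S n * fact n)%nat.
      replace (fact (S n)) with (S n * fact n)%nat by reflexivity.
      rewrite mult_INR. simpl pow. field. auto.
Qed.

Lemma is_derive_lower_gamma (n : nat) (s : R) :
  is_derive (lower_gamma n) s (s ^ n * exp (- s)).
Proof.
  replace (s ^ n * exp (- s)) with
    (INR (fact n) * (0 - - (exp (- s) * (s ^ n / INR (fact n))))).
  - apply (is_derive_scal (fun x =>
      1 - exp (- x) * sum_f_R0 (fun k => x ^ k / INR (fact k)) n)).
    apply (is_derive_minus (V := R_NormedModule)).
    + apply (is_derive_const (V := R_NormedModule)).
    + apply is_derive_exp_taylor.
  - field. apply INR_fact_neq_0.
Qed.

Lemma lower_gamma_0 (n : nat) : lower_gamma n 0 = 0.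
Proof.
  unfold lower_gamma. rewrite Ropp_0, exp_0.
  replace (sum_f_R0 (fun k => 0 ^ k / INR (fact k)) n) with 1; [ring|].
  induction n as [|n IH]; simpl sum_f_R0; [simpl; field|].
  rewrite <- IH. simpl pow. unfold Rdiv. ring.
Qed.

Lemma is_derive_pow_exp (n : nat) (s : R) :
  is_derive (fun x => x ^ S n * exp (- x)) s
    (s ^ n * exp (- s) * (INR n + 1 - s)).
Proof.
  auto_derive; [exact I|].
  change (match n with 0%nat => 1 | S _ => INR n + 1 end) with (INR (S n)).
  rewrite S_INR. simpl. ring.
Qed.

Lemma pow_exp_pos (n : nat) (s : R) : 0 < s -> 0 < s ^ n * exp (- s).
Proof.
  intros Hs. apply Rmult_lt_0_compat; [now apply pow_lt|apply exp_pos].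
Qed.

Lemma lower_gamma_pos (n : nat) (s : R) : 0 < s -> 0 < lower_gamma n s.
Proof.
  apply pos_of_derive_pos_0 with (fun x => x ^ n * exp (- x)).
  - apply is_derive_lower_gamma.
  - apply pow_exp_pos.
  - apply lower_gamma_0.
Qed.

(** * The logarithmic rate and its Riccati equation *)

(** The logarithmic derivative [s * g' s / g s] of the incomplete gamma
    function [g]: the value of [delta] for which [s] solves the equation. *)
Definition rate (n : nat) (s : R) : R :=
  s ^ S n * exp (- s) / lower_gamma n s.

Lemma rate_mul_lower_gamma (n : nat) (s : R) :
  0 < s -> rate n s * lower_gamma n s = s ^ S n * exp (- s).
Proof.
  intros Hs. unfold rate. field.
  apply Rgt_not_eq, lower_gamma_pos, Hs.
Qed.

Lemma rate_pos (n : nat) (s : R) : 0 < s -> 0 < rate n s.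
Proof.
  intros Hs. apply Rdiv_lt_0_compat.
  - now apply (pow_exp_pos (S n)).
  - now apply lower_gamma_pos.
Qed.

Lemma s_equation_iff_rate (n : nat) (delta s : R) :
  0 < delta -> 0 < s -> (s_equation n delta s <-> rate n s = delta).
Proof.
  intros Hd Hs.
  assert (HG := lower_gamma_pos n s Hs).
  assert (Hr := rate_mul_lower_gamma n s Hs).
  assert (Hf := INR_fact_lt_0 n).
  assert (HE : exp s * exp (- s) = 1) by (rewrite <- exp_plus, Rplus_opp_r; apply exp_0).
  assert (He := exp_pos s). assert (He' := exp_pos (- s)).
  (* The defect of the equation, up to a nonzero factor. *)
  assert (Hdef : exp (- s) * (delta * INR (fact n)) *
     (exp s - (sum_f_R0 (fun k => s ^ k / INR (fact k)) n
               + 1 / delta * (s ^ (n + 1) / INR (fact n))))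
     = (delta - rate n s) * lower_gamma n s).
  { rewrite Rmult_minus_distr_r, Hr. unfold lower_gamma.
    rewrite PeanoNat.Nat.add_1_r.
    rewrite <- HE at 2. field. lra. }
  unfold s_equation. split; intros H.
  - rewrite <- H, Rminus_diag, Rmult_0_r in Hdef.
    symmetry in Hdef. apply Rmult_integral in Hdef. lra.
  - rewrite H, Rminus_diag, Rmult_0_l in Hdef.
    apply Rmult_integral in Hdef. destruct Hdef as [Hz|Hz]; [|lra].
    exfalso. revert Hz. apply Rgt_not_eq.
    repeat apply Rmult_lt_0_compat; assumption.
Qed.

Lemma is_derive_rate (n : nat) (s : R) : 0 < s ->
  is_derive (rate n) s (rate n s * (INR n + 1 - s - rate n s) / s).
Proof.
  intros Hs. assert (HG := lower_gamma_pos n s Hs).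
  replace (rate n s * (INR n + 1 - s - rate n s) / s) with
    ((s ^ n * exp (- s) * (INR n + 1 - s) * lower_gamma n s
      - s ^ S n * exp (- s) * (s ^ n * exp (- s))) / lower_gamma n s ^ 2).
  - apply (is_derive_div (fun x => x ^ S n * exp (- x)) (lower_gamma n)).
    + apply is_derive_pow_exp.
    + apply is_derive_lower_gamma.
    + lra.
  - unfold rate. simpl pow. field. lra.
Qed.

(** [s * g' - (N - s) * g] vanishes at [0] and has derivative [g]. *)
Lemma rate_gt (n : nat) (s : R) : 0 < s -> INR n + 1 - s < rate n s.
Proof.
  intros Hs. assert (HG := lower_gamma_pos n s Hs).
  apply Rmult_lt_reg_r with (lower_gamma n s); [exact HG|].
  rewrite rate_mul_lower_gamma by exact Hs. apply Rlt_0_minus.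
  clear HG. revert s Hs.
  apply (pos_of_derive_pos_0 (fun x => x ^ S n * exp (- x)
                     - (INR n + 1 - x) * lower_gamma n x) (lower_gamma n)).
  - intros x.
    replace (lower_gamma n x) with
      (x ^ n * exp (- x) * (INR n + 1 - x)
       - ((0 - 1) * lower_gamma n x + (INR n + 1 - x) * (x ^ n * exp (- x))))
      by ring.
    apply (is_derive_minus (V := R_NormedModule)); [apply is_derive_pow_exp|].
    apply (is_derive_mult (fun x => INR n + 1 - x)).
    + auto_derive; [exact I|ring].
    + apply is_derive_lower_gamma.
    + intros; apply Rmult_comm.
  - apply lower_gamma_pos.
  - rewrite lower_gamma_0. simpl. ring.
Qed.

(** [g - s^N * exp (- s) / N] vanishes at [0] and has derivative
    [s^N * exp (- s) / N]. *)
Lemma rate_lt (n : nat) (s : R) : 0 < s -> rate n s < INR n + 1.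
Proof.
  intros Hs. assert (HG := lower_gamma_pos n s Hs).
  apply Rmult_lt_reg_r with (lower_gamma n s); [exact HG|].
  rewrite rate_mul_lower_gamma by exact Hs. apply Rlt_0_minus.
  clear HG. revert s Hs.
  apply (pos_of_derive_pos_0 (fun x => (INR n + 1) * lower_gamma n x
           - x ^ S n * exp (- x)) (fun x => x ^ S n * exp (- x))).
  - intros x.
    replace (x ^ S n * exp (- x)) with
      ((INR n + 1) * (x ^ n * exp (- x))
        - x ^ n * exp (- x) * (INR n + 1 - x)) by (simpl; ring).
    apply (is_derive_minus (V := R_NormedModule)); [|apply is_derive_pow_exp].
    apply (is_derive_scal (lower_gamma n)), is_derive_lower_gamma.
  - apply (pow_exp_pos (S n)).
  - rewrite lower_gamma_0. simpl. ring.
Qed.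

Lemma rate_decreasing (n : nat) (a b : R) :
  0 < a -> a < b -> rate n b < rate n a.
Proof.
  intros Ha Hab. apply Ropp_lt_cancel.
  apply (incr_function (fun x => - rate n x) (Finite 0) p_infty
    (fun x => - (rate n x * (INR n + 1 - x - rate n x) / x)));
    simpl; auto.
  - intros x Hx _. apply (is_derive_opp (V := R_NormedModule) (rate n)).
    now apply is_derive_rate.
  - intros x Hx _.
    assert (Hr := rate_pos n x Hx). assert (Hg := rate_gt n x Hx).
    replace (- (rate n x * (INR n + 1 - x - rate n x) / x)) with
      (rate n x * (rate n x - (INR n + 1 - x)) / x) by (field; lra).
    apply Rdiv_lt_0_compat; [|exact Hx].
    apply Rmult_lt_0_compat; lra.
Qed.

(** * The two bounds, as inequalities for the rate *)

(** This is [H] of the introduction: after multiplication by the integrating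
    factor [g] its derivative is [g' * u^2]. Near [0],
    [H * g >= g * d * u >= - s * (s * g')], by [d < N]. *)
Lemma gap_pos (n : nat) (s : R) : 0 < s ->
  0 < (INR n + 1 - rate n s) * (1 + rate n s) - s * rate n s.
Proof.
  intros Hs. apply Rmult_lt_reg_r with (lower_gamma n s).
  { now apply lower_gamma_pos. }
  rewrite Rmult_0_l. revert s Hs.
  apply (pos_of_derive_pos
    (fun x => ((INR n + 1 - rate n x) * (1 + rate n x) - x * rate n x)
              * lower_gamma n x)
    (fun x => x ^ n * exp (- x) * (INR n + 1 - x - rate n x) ^ 2)
    (fun x => - (x * (x ^ S n * exp (- x))))).
  - intros x Hx. assert (HG := lower_gamma_pos n x Hx).
    assert (DR := is_derive_rate n x Hx).
    assert (DG := is_derive_lower_gamma n x).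
    auto_derive.
    + repeat split; eexists; eassumption.
    + change (fun y => rate n y) with (rate n).
      rewrite (is_derive_unique _ _ _ DR).
      change (fun y => lower_gamma n y) with (lower_gamma n).
      rewrite (is_derive_unique _ _ _ DG).
      assert (Hr := rate_mul_lower_gamma n x Hx).
      replace (x ^ n * exp (- x)) with (rate n x * lower_gamma n x / x)
        by (rewrite Hr; simpl; field; lra).
      field. lra.
  - intros x Hx. assert (Hg := rate_gt n x Hx).
    apply Rmult_lt_0_compat; [now apply pow_exp_pos|].
    apply pow2_gt_0. lra.
  - apply derivable_continuous_pt.
    eexists. apply is_derive_Reals. auto_derive; [exact I|reflexivity].
  - ring.
  - intros x Hx. assert (HG := lower_gamma_pos n x Hx).
    rewrite <- (rate_mul_lower_gamma n x Hx).
    assert (Hr := rate_pos n x Hx). assert (Hl := rate_lt n x Hx).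
    replace (- (x * (rate n x * lower_gamma n x))) with
      ((- (x * rate n x)) * lower_gamma n x) by ring.
    apply Rmult_le_compat_r; [lra|].
    assert (0 < (INR n + 1 - rate n x) * (1 + rate n x))
      by (apply Rmult_lt_0_compat; lra).
    lra.
Qed.

(** [s^N - N * g] vanishes at [0] and has derivative
    [N * s^n * (1 - exp (- s))]. *)
Lemma rate_gt_exp (n : nat) (s : R) :
  0 < s -> (INR n + 1) * exp (- s) < rate n s.
Proof.
  intros Hs. assert (HG := lower_gamma_pos n s Hs).
  apply Rmult_lt_reg_r with (lower_gamma n s); [exact HG|].
  rewrite rate_mul_lower_gamma by exact Hs.
  replace ((INR n + 1) * exp (- s) * lower_gamma n s) with
    ((INR n + 1) * lower_gamma n s * exp (- s)) by ring.
  apply Rmult_lt_compat_r; [apply exp_pos|]. apply Rlt_0_minus.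
  clear HG. revert s Hs.
  apply (pos_of_derive_pos_0 (fun x => x ^ S n - (INR n + 1) * lower_gamma n x)
           (fun x => (INR n + 1) * x ^ n * (1 - exp (- x)))).
  - intros x.
    replace ((INR n + 1) * x ^ n * (1 - exp (- x))) with
      (INR (S n) * x ^ n - (INR n + 1) * (x ^ n * exp (- x)))
      by (rewrite S_INR; ring).
    apply (is_derive_minus (V := R_NormedModule)).
    + apply is_derive_Reals, (derivable_pt_lim_pow x (S n)).
    + apply (is_derive_scal (lower_gamma n)), is_derive_lower_gamma.
  - intros x Hx. apply Rmult_lt_0_compat.
    + apply Rmult_lt_0_compat; [|now apply pow_lt].
      assert (H := pos_INR n). lra.
    + assert (exp (- x) < exp 0) by (apply exp_increasing; lra).
      rewrite exp_0 in *. lra.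
  - rewrite lower_gamma_0. simpl. ring.
Qed.

(** This is [K] of the introduction: its derivative is [H / s]. Near [0], the
    estimate [d > N * exp (- s)] bounds [K] below by [N * exp (- s) - N]. *)
Lemma log_gap_pos (n : nat) (s : R) : 0 < s ->
  0 < s - (INR n + 1) + rate n s + ln (rate n s / (INR n + 1)).
Proof.
  assert (HN : 0 < INR n + 1) by (assert (H := pos_INR n); lra).
  revert s.
  apply (pos_of_derive_pos
    (fun x => x - (INR n + 1) + rate n x + ln (rate n x / (INR n + 1)))
    (fun x => ((INR n + 1 - rate n x) * (1 + rate n x) - x * rate n x) / x)
    (fun x => (INR n + 1) * exp (- x) - (INR n + 1))).
  - intros x Hx. assert (Hr := rate_pos n x Hx).
    assert (DR := is_derive_rate n x Hx).
    auto_derive.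
    + repeat split; try (eexists; eassumption).
      now apply Rdiv_lt_0_compat.
    + change (fun y => rate n y) with (rate n).
      rewrite (is_derive_unique _ _ _ DR).
      field. lra.
  - intros x Hx. apply Rdiv_lt_0_compat; [now apply gap_pos|exact Hx].
  - apply derivable_continuous_pt.
    eexists. apply is_derive_Reals. auto_derive; [exact I|reflexivity].
  - rewrite Ropp_0, exp_0. ring.
  - intros x Hx. assert (He := rate_gt_exp n x Hx).
    assert (Hln : - x < ln (rate n x / (INR n + 1))).
    { rewrite <- (ln_exp (- x)). apply ln_increasing; [apply exp_pos|].
      apply Rmult_lt_reg_r with (INR n + 1); [exact HN|].
      unfold Rdiv. rewrite Rmult_assoc, Rinv_l by lra. lra. }
    lra.
Qed.

(** * Existence and uniqueness of the solution *)

Lemma rate_surjective (n : nat) (delta : R) : 0 < delta < INR n + 1 ->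
  exists s, 0 < s /\ rate n s = delta.
Proof.
  intros [Hd0 HdN].
  set (N := INR n + 1) in *.
  (* [N - delta] undershoots because [u < 0]; [N * (N + 1) / delta] overshoots
     because [gap_pos] gives [s * d s < N * (N + 1)]. *)
  set (a := N - delta). set (b := N * (N + 1) / delta).
  assert (Ha : 0 < a) by (unfold a; lra).
  assert (Hbd : b * delta = N * (N + 1)) by (unfold b; field; lra).
  assert (Hab : a < b).
  { apply Rmult_lt_reg_r with delta; [exact Hd0|]. rewrite Hbd. unfold a. nra. }
  assert (Hra : delta < rate n a).
  { assert (H := rate_gt n a Ha). unfold a in *. fold N in H. lra. }
  assert (Hrb : rate n b < delta).
  { assert (Hb : 0 < b) by lra.
    assert (H := gap_pos n b Hb). fold N in H.
    assert (H' := rate_lt n b Hb). fold N in H'.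
    assert (H'' := rate_pos n b Hb).
    apply Rmult_lt_reg_l with b; [exact Hb|]. rewrite Hbd. nra. }
  destruct (IVT_interv (fun s => delta - rate n s) a b) as [z [Hz Hz0]];
    try lra.
  - intros x Hx. apply derivable_continuous_pt.
    eexists. apply derivable_pt_lim_minus.
    + apply derivable_pt_lim_const.
    + apply is_derive_Reals, is_derive_rate. lra.
  - exists z. split; lra.
Qed.

Lemma s_spec (n : nat) (delta : R) : 0 < delta < INR n + 1 ->
  0 < s_ n delta /\ rate n (s_ n delta) = delta.
Proof.
  intros Hd. destruct (rate_surjective n delta Hd) as [s [Hs Hrs]].
  assert (Hex : exists x, unique (fun s => 0 < s /\ s_equation n delta s) x).
  { exists s. split.
    - split; [exact Hs|]. now apply s_equation_iff_rate.
    - intros t [Ht Het]. apply s_equation_iff_rate in Het; [|lra|exact Ht].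
      destruct (Rtotal_order s t) as [H|[H|H]]; [|exact H|].
      + assert (H' := rate_decreasing n s t Hs H). lra.
      + assert (H' := rate_decreasing n t s Ht H). lra. }
  destruct (epsilon_spec (inhabits 0) _ Hex) as [[Hp He] _].
  fold (s_ n delta) in Hp, He.
  split; [exact Hp|]. apply s_equation_iff_rate; [lra|exact Hp|exact He].
Qed.

Theorem proposition6 :
  forall (n : nat) (delta : R), 0 < delta < INR n + 1 ->
    ln ((INR n + 1) / delta) + (INR n + 1 - delta) < s_ n delta
      < (INR n + 1 - delta) + (INR n + 1 - delta) / delta.
Proof.
  intros n delta Hd. destruct (s_spec n delta Hd) as [Hs Hr].
  assert (HK := log_gap_pos n _ Hs). assert (HH := gap_pos n _ Hs).
  rewrite Hr in HK, HH. split.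
  - replace ((INR n + 1) / delta) with (/ (delta / (INR n + 1)))
      by (field; lra).
    rewrite ln_Rinv by (apply Rdiv_lt_0_compat; lra). lra.
  - apply Rmult_lt_reg_r with delta; [lra|].
    replace ((INR n + 1 - delta + (INR n + 1 - delta) / delta) * delta)
      with ((INR n + 1 - delta) * (1 + delta)) by (field; lra).
    lra.
Qed.
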